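(* Let $r$ be a positive integer and $m$ a nonnegative integer with $r$-binomial representation $m=\sum_{i=t}^{r}\binom{a_i}{i}$. Then $\kappa_r(m)=\kappa_r^*(m)$ if and only if $a_i\ge 2i-1$ for all $i=t,t+1,\dots,r$.
   Context: Every nonnegative integer $m$ has a unique $r$-binomial representation $m=\sum_{i=t}^{r}\binom{a_i}{i}$ with $a_r>a_{r-1}>\dots>a_t\ge t\ge1$ (empty sum for $m=0$). The Kruskal–Katona function is $\kappa_r(m):=\sum_{i=t}^{r}\binom{a_i}{i-1}-m$ (equal to $|\Delta F_{n,r}(m)|-m$ whenever $m\le\binom nr$, where $F_{n,r}(m)$ is the family of the first $m$ $r$-subsets of $\{1,\dots,n\}$ in squashed order and $\Delta$ is the shadow), and $\kappa_r^*(m):=\min_{0\le j\le m}\kappa_r(j)$. *)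

(* Defs.v *)
From mathcomp Require Import all_boot all_order all_algebra.
Set Implicit Arguments.
Unset Strict Implicit.
Unset Printing Implicit Defensive.

(* [is_binrep r m t a]: m = \sum_(t <= i <= r) 'C(a i, i) with
   a r > a (r-1) > ... > a t >= t >= 1.  Only the values a t, ..., a r matter.
   The empty sum is encoded by t = r.+1, which forces m = 0. *)
Definition is_binrep (r m t : nat) (a : nat -> nat) : bool :=
  [&& 0 < t <= r.+1,
      (t <= r) ==> (t <= a t),
      [forall i : 'I_r, (t <= i) ==> (a i < a i.+1)]
    & m == \sum_(t <= i < r.+1) 'C(a i, i)].

Lemma is_binrepP r m t a :
  reflect [/\ 0 < t <= r.+1,
              t <= r -> t <= a t,
              forall i, t <= i < r -> a i < a i.+1
            & m = \sum_(t <= i < r.+1) 'C(a i, i)]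
          (is_binrep r m t a).
Proof.
apply: (iffP and4P) => [[ht /implyP ha /forallP hi /eqP hm]|[ht ha hi ->]].
  split=> // i /andP[ti ir].
  by have /implyP := hi (Ordinal ir); apply.
split=> //; first exact/implyP.
by apply/forallP => i; apply/implyP => ti; apply: hi; rewrite ti /=.
Qed.

Lemma eq_binrep r m t a b :
  (forall i, i <= r -> a i = b i) -> is_binrep r m t a -> is_binrep r m t b.
Proof.
move=> ab /is_binrepP[ht ha hi ->]; apply/is_binrepP; split=> //.
- by move=> tr; rewrite -ab //; apply: ha.
- by move=> i /andP[ti ir]; rewrite -!ab ?(ltnW ir) //; apply: hi; rewrite ti.
- by apply: eq_big_nat => i /andP[_ ir]; rewrite ab.
Qed.

Lemma binrep_top r m t a : is_binrep r.+1 m t a -> t <= r.+1 ->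
  [/\ 'C(a r.+1, r.+1) <= m, r.+1 <= a r.+1, t <= r -> a r < a r.+1
    & is_binrep r (m - 'C(a r.+1, r.+1)) t a].
Proof.
move=> /is_binrepP[/andP[t0 _] ha hi ->] tr; rewrite big_nat_recr //=.
have hge i : t <= i <= r.+1 -> i <= a i.
  elim: i => [|i IH] // /andP[]; rewrite leq_eqVlt => /orP[/eqP <- _|ti ir].
    exact: ha.
  have hi' : a i < a i.+1 by apply: hi; rewrite ir andbT -ltnS.
  by apply: leq_ltn_trans hi'; apply: IH; rewrite -ltnS ti ltnW.
split; first exact: leq_addl.
- by apply: hge; rewrite tr leqnn.
- by move=> h; apply: hi; rewrite h /=.
- apply/is_binrepP; split.
  + by rewrite t0.
  + by move=> _; apply: ha.
  + by move=> i /andP[ti ir]; apply: hi; rewrite ti ltnW.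
  + by rewrite addnK.
Qed.

Lemma binrep_lt r m t a :
  is_binrep r m t a -> t <= r -> m < 'C((a r).+1, r).
Proof.
elim: r m => [|r IH] m h tr.
  by move/is_binrepP: h => [/andP[/lt0n_neq0]]; move: tr; case: t.
have [hm hr hlt hrep] := binrep_top h tr.
rewrite binS -ltn_subLR // -(ltn_add2l 'C(a r.+1, r.+1)) addnC.
have [tr'|rt] := leqP t r.
  have lt1 := IH _ hrep tr'.
  by rewrite addnC ltn_add2l (leq_trans lt1) // leq_bin2l // hlt.
have t_eq : t = r.+1 by apply/eqP; rewrite eqn_leq tr.
move/is_binrepP: hrep => [_ _ _]; rewrite t_eq big_geq // => ->.
by rewrite addnC ltn_add2l bin_gt0 ltnW.
Qed.

Lemma ltn_bin_addn m r : m < 'C((m + r).+1, r.+1).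
Proof.
elim: m => [|m IH]; first by rewrite binn.
by rewrite addSn binS (leq_trans (n := m.+1 + 1)) ?addn1 // -addn1 leq_add //
           bin_gt0 -addSn leq_addl.
Qed.

Lemma binrep_ex_fun r m : (0 < r) || (m == 0) ->
  exists t a, is_binrep r m t a.
Proof.
elim: r m => [|r IH] m hr.
  exists 1, id; apply/is_binrepP; split=> //.
    by move/eqP: hr => ->; rewrite big_geq.
have [->|m0] := posnP m.
  exists r.+2, id; apply/is_binrepP; split=> //; first by rewrite leqnn.
  by rewrite big_geq.
have ex : exists n, m < 'C(n.+1, r.+1) by exists (m + r); exact: ltn_bin_addn.
case: (ex_minnP ex) => n hn nmin.
have hle : 'C(n, r.+1) <= m.
  case: n hn nmin => [|n] _ nmin; first by rewrite bin0n.
  by rewrite leqNgt; apply/negP => /nmin; rewrite ltnn.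
have rn : r < n.
  rewrite ltnNge; apply/negP => nr.
  have : 'C(n.+1, r.+1) <= 'C(r.+1, r.+1) by rewrite leq_bin2l.
  by rewrite binn => /(leq_trans hn); rewrite ltnNge m0.
have hrest : m - 'C(n, r.+1) < 'C(n, r) by rewrite ltn_subLR // -binS.
have hr' : (0 < r) || (m - 'C(n, r.+1) == 0).
  by move: hrest; case: (r) => // ; rewrite bin0 ltnS leqn0.
have [t [a hrep]] := IH _ hr'.
have /is_binrepP[/andP[t0 tr] ha hi hsum] := hrep.
exists t, (fun i => if i == r.+1 then n else a i); apply/is_binrepP; split.
- by rewrite t0 (leq_trans tr).
- by move=> _; case: eqP => [->|/eqP ne] //; apply: ha; rewrite -ltnS ltn_neqAle ne.
- move=> i /andP[ti ir]; rewrite (ltn_eqF ir) eqSS.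
  case: eqP => [ei|/eqP ne]; last by apply: hi; rewrite ti ltn_neqAle ne -ltnS.
  move: ti; rewrite ei => tr'; rewrite ltnNge; apply/negP => na.
  move: hrest; rewrite hsum big_nat_recr //= ltnNge.
  by rewrite (leq_trans (leq_bin2l r na)) // leq_addl.
- rewrite big_nat_recr //= eqxx -[LHS](subnK hle) hsum; congr addn.
  by apply: eq_big_nat => i /andP[_ ir]; rewrite (ltn_eqF ir).
Qed.

Lemma binrep_ex r m :
  exists ta : nat * seq nat, (0 < r) ==> is_binrep r m ta.1 (nth 0 ta.2).
Proof.
have [->|r0] := posnP r; first by exists (0, [::]).
have [|t [a h]] := @binrep_ex_fun r m; first by rewrite r0.
exists (t, mkseq a r.+1); apply: eq_binrep h => i ir /=.
by rewrite nth_mkseq.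
Qed.

Lemma binrep_uniq r m t a t' a' :
  is_binrep r m t a -> is_binrep r m t' a' ->
  t = t' /\ forall i, t <= i <= r -> a i = a' i.
Proof.
have pos s u b : is_binrep r s u b -> s = 0 -> u = r.+1.
  case: r => [|r'] h s0.
    by move/is_binrepP: h => [/andP[]]; case: u => [|[|]].
  have [ur|] := leqP u r'.+1; last first.
    by move/is_binrepP: h => [/andP[_ h1] _ _ _ h2]; apply/eqP; rewrite eqn_leq h1.
  have [+ hr _ _] := binrep_top h ur.
  by rewrite s0 leqNgt bin_gt0 hr.
have [m0|mpos] := posnP m.
  move=> h h'; rewrite (pos _ _ _ h m0) (pos _ _ _ h' m0); split=> // i.
  by case/andP=> h1 h2; have := leq_trans h1 h2; rewrite ltnn.
have npos s u b : is_binrep r s u b -> 0 < s -> u <= r.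
  move=> /is_binrepP[_ _ _ ->]; apply: contraLR; rewrite -ltnNge => ru.
  by rewrite big_geq.
move=> h h'; have := npos _ _ _ h mpos; have := npos _ _ _ h' mpos.
move: h h'; clear pos npos mpos.
elim: r m => [|r IH] m h h' t'r tr.
  by move/is_binrepP: h => [/andP[]]; move: tr; case: (t).
have [h1 h2 _ h4] := binrep_top h tr.
have [h1' h2' _ h4'] := binrep_top h' t'r.
have le_top b c u v : is_binrep r.+1 m u b -> is_binrep r.+1 m v c ->
    u <= r.+1 -> v <= r.+1 -> b r.+1 <= c r.+1.
  move=> hb hc ur vr; rewrite leqNgt; apply/negP => cb.
  have [le1 _ _ _] := binrep_top hb ur.
  have lt1 := binrep_lt hc vr.
  by have := leq_trans lt1 (leq_trans (leq_bin2l r.+1 cb) le1); rewrite ltnn.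
have top : a r.+1 = a' r.+1.
  by apply/eqP; rewrite eqn_leq (le_top a a' t t') ?(le_top a' a t' t).
rewrite -top in h4'.
have empty u b s : is_binrep r s u b -> r < u -> s = 0.
  by move=> /is_binrepP[_ _ _ ->] ru; rewrite big_geq.
have nempty u b s : is_binrep r s u b -> u <= r -> s <> 0.
  case: (r) => [|r'] hb ur.
    by move/is_binrepP: hb => [/andP[]]; move: ur; case: u.
  have [+ hr _ _] := binrep_top hb ur => /[swap] ->.
  by rewrite leqNgt bin_gt0 hr.
have [tr'|rt] := leqP t r; have [t'r'|rt'] := leqP t' r.
- have [tt' E] := IH _ h4 h4' t'r' tr'; split=> // i /andP[ti].
  rewrite leq_eqVlt => /orP[/eqP -> //|ir]; apply: E; rewrite ti.
  by rewrite -ltnS.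
- by case: (nempty _ _ _ h4 tr' (empty _ _ _ h4' rt')).
- by case: (nempty _ _ _ h4' t'r' (empty _ _ _ h4 rt)).
- have et : t = r.+1 by apply/eqP; rewrite eqn_leq tr.
  have et' : t' = r.+1 by apply/eqP; rewrite eqn_leq t'r.
  split; first by rewrite et et'.
  by move=> i /andP[ti ir]; have -> : i = r.+1 by apply/eqP; rewrite eqn_leq ir -et.
Qed.

(* The r-binomial representation (t, a) of m; it carries no meaning for r = 0. *)
Definition binrep (r m : nat) : nat * (nat -> nat) :=
  let ta := xchoose (binrep_ex r m) in (ta.1, nth 0 ta.2).

Lemma binrep_correct r m :
  0 < r -> is_binrep r m (binrep r m).1 (binrep r m).2.
Proof. by move=> r0; have /implyP := xchooseP (binrep_ex r m); apply. Qed.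

(* kappa can be negative, hence the values in int. *)
Definition kappa (r m : nat) : int :=
  let: (t, a) := binrep r m in
  ((\sum_(t <= i < r.+1) 'C(a i, i.-1))%N%:Z - m%:Z)%R.

Lemma kappaE r m t a : 0 < r -> is_binrep r m t a ->
  kappa r m = ((\sum_(t <= i < r.+1) 'C(a i, i.-1))%N%:Z - m%:Z)%R.
Proof.
move=> r0 h; rewrite /kappa; have := binrep_correct m r0.
case: (binrep r m) => t' a' /= h'.
have [-> E] := binrep_uniq h' h; congr (_%:Z - _)%R.
apply: eq_big_nat => i /andP[ti ir]; rewrite E //.
by have [-> _] := binrep_uniq h' h; rewrite ti -ltnS.
Qed.

(* The default value kappa r 0 is itself in the range of the minimum. *)
Definition kappa_star (r m : nat) : int :=
  \big[Order.min/kappa r 0]_(0 <= j < m.+1) kappa r j.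

(* Main.v *)
(* Write kk i n = 'C(n, i-1) - 'C(n, i), so that kappa is the sum of the
   kk i (a i).  Pascal's rule gives kk (r+1) n + kk r n = kk (r+1) (n+1), and,
   for n >= i-1, kk i n is positive if n < 2i-1, zero if n = 2i-1 and negative
   if n > 2i-1.  Peeling off the top term, induction on r then shows that
   kappa_r(j) >= kk r n for every j < 'C(n, r) as soon as n >= 2r-1, strictly
   when n >= 2r.
   If all a i >= 2i-1, this bound handles the j whose top entry is smaller than
   that of m, and the induction hypothesis those with the same top entry.
   Conversely, let i be the largest index with a i < 2i-1; truncating the
   representation of m just above i strictly decreases kappa. *)
Require Import Defs.
From mathcomp Require Import all_boot all_order all_algebra.
From mathcomp Require Import zify.

Import Order.TTheory GRing.Theory Num.Theory.

(* kk 0 n stands for 'C(n, -1) - 'C(n, 0), which makes kkS hold at r = 0. *)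
Definition kk (r n : nat) : int :=
  if r is r'.+1 then ('C(n, r')%:Z - 'C(n, r)%:Z)%R else (-1)%R.

Definition krep (r t : nat) (a : nat -> nat) : int :=
  (\sum_(t <= i < r.+1) kk i (a i))%R.

Lemma kkS r n : (kk r.+1 n + kk r n = kk r.+1 n.+1)%R.
Proof.
case: r => [|r] /=; first by rewrite !bin0 !bin1; lia.
by rewrite !binS; lia.
Qed.

(** Since [r.+1 * 'C(n, r.+1) = (n - r) * 'C(n, r)], the sign of [kk r.+1 n] is that of [2r + 1 - n]
    wherever ['C(n, r)] is nonzero; the next lemmas use this too. *)
Lemma kk_ge0 r n : n <= r.*2.+1 -> (0 <= kk r.+1 n)%R.
Proof.
move=> nr /=; rewrite subr_ge0 lez_nat -(leq_pmul2l (ltn0Sn r)) mul_bin_left.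
by rewrite leq_mul2r; apply/orP; right; lia.
Qed.

Lemma kk_gt0 r n : r <= n <= r.*2 -> (0 < kk r.+1 n)%R.
Proof.
move=> /andP[rn nr] /=.
rewrite subr_gt0 ltz_nat -(ltn_pmul2l (ltn0Sn r)) mul_bin_left.
by rewrite ltn_pmul2r ?bin_gt0 //; lia.
Qed.

Lemma kk_le0 r n : r.*2.-1 <= n -> (kk r n <= 0)%R.
Proof.
case: r => [|r] // rn /=.
rewrite subr_le0 lez_nat -(leq_pmul2l (ltn0Sn r)) mul_bin_left.
by rewrite leq_mul2r; apply/orP; right; lia.
Qed.

Lemma kk_lt0 r n : r.*2 <= n -> (kk r n < 0)%R.
Proof.
case: r => [|r] // rn /=.
rewrite subr_lt0 ltz_nat -(ltn_pmul2l (ltn0Sn r)) mul_bin_left.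
by rewrite ltn_pmul2r ?bin_gt0; lia.
Qed.

Lemma kk_odd r : kk r.+1 r.*2.+1 = 0%R.
Proof.
by apply/eqP; rewrite eq_le kk_ge0 // andbT kk_le0.
Qed.

(** By [kkS], passing from [n] to [n.+1] adds [kk r n], nonpositive from [2r - 1] on. *)
Lemma kk_anti r p n : r.*2.-1 <= p <= n -> (kk r.+1 n <= kk r.+1 p)%R.
Proof.
move=> /andP[rp /subnKC <-]; elim: (n - p) => [|d IH]; first by rewrite addn0.
by apply: le_trans IH; rewrite addnS -kkS gerDl kk_le0 // (leq_trans rp) ?leq_addr.
Qed.

Lemma krep_empty r a : krep r r.+1 a = 0%R.
Proof. by rewrite /krep big_geq. Qed.

Lemma krepS r t a : t <= r.+1 ->
  krep r.+1 t a = (krep r t a + kk r.+1 (a r.+1))%R.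
Proof. by move=> tr; rewrite /krep big_nat_recr. Qed.

Lemma kappa_krep {r m t a} : 0 < r -> is_binrep r m t a -> kappa r m = krep r t a.
Proof.
move=> r0 h; rewrite (kappaE r0 h).
have /is_binrepP[/andP[t0 _] _ _ ->] := h.
rewrite !(big_morph Posz PoszD (erefl 0%Z)) -sumrB; apply: eq_big_nat => i.
by case: i => [|i] // /andP[]; case: (t) t0.
Qed.

Lemma binrep_empty r a : is_binrep r 0 r.+1 a.
Proof.
by apply/is_binrepP; rewrite leqnn ltnn big_geq //; split=> // i; lia.
Qed.

Lemma binrep_rest_lt {r m t a} : is_binrep r.+1 m t a -> t <= r.+1 ->
  m - 'C(a r.+1, r.+1) < 'C(a r.+1, r).
Proof.
move=> h tr; have [hm _ _ _] := binrep_top h tr.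
by rewrite ltn_subLR // -binS; apply: binrep_lt h tr.
Qed.

Lemma binrep_top_le {r m t a n} : is_binrep r.+1 m t a -> t <= r.+1 ->
  m < 'C(n, r.+1) -> a r.+1 < n.
Proof.
move=> h tr mn; rewrite ltnNge; apply/negP => na.
have [hm _ _ _] := binrep_top h tr.
by move: (leq_ltn_trans hm mn); rewrite ltnNge leq_bin2l.
Qed.

Lemma binrep_t_cases {r m t a} : is_binrep r m t a -> t <= r \/ t = r.+1.
Proof. by case/is_binrepP=> /andP[_ h] _ _ _; lia. Qed.

Lemma kk_le_krep r j t a n : is_binrep r j t a -> j < 'C(n, r) ->
  r.*2.-1 <= n -> (kk r n <= krep r t a)%R.
Proof.
elim: r j n => [|r IH] j n h jn rn.
  have [|->] := binrep_t_cases h; last by rewrite krep_empty.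
  by move/is_binrepP: h => [/andP[]]; lia.
have [tr|->] := binrep_t_cases h; last by rewrite krep_empty kk_le0.
have pn := binrep_top_le h tr jn; have j'p := binrep_rest_lt h tr.
have [_ _ _ h'] := binrep_top h tr.
rewrite krepS //; move: pn j'p h'; move: (a r.+1) => p pn j'p h'.
have [rp|pr] := leqP r.*2.-1 p.
  apply: (@le_trans _ _ (kk r.+1 p.+1)); first by apply: kk_anti; lia.
  (* Pascal splits [kk r.+1 p.+1] into the top term and [kk r p], which bounds the remainder, itself
     below ['C(p, r)]. *)
  by rewrite -kkS addrC lerD2r; apply: IH h' j'p rp.
apply: (@le_trans _ _ 0%R); first exact: kk_le0.
apply: addr_ge0; last by apply: kk_ge0; lia.
case: r IH pr {h jn rn tr} j'p h' => [|r] IH pr j'p h'; first lia.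
(* The bound [0] is the vanishing value [kk r.+1 r.*2.+1], so the induction hypothesis applies with
   [n = r.*2.+1]. *)
rewrite -(kk_odd r); apply: IH h' _ _; last by lia.
by apply: leq_trans j'p _; apply: leq_bin2l; lia.
Qed.

Lemma krep_ge0 r j t a : is_binrep r j t a -> j < 'C(r.*2.-1, r) ->
  (0 <= krep r t a)%R.
Proof.
case: r => [|r] h jn; last by rewrite -(kk_odd r); apply: kk_le_krep h jn _.
have [|->] := binrep_t_cases h; last by rewrite krep_empty.
by move/is_binrepP: h => [/andP[]]; lia.
Qed.

Lemma kk_lt_krep r j t a n : is_binrep r j t a -> j < 'C(n, r) ->
  r.*2 <= n -> (kk r n < krep r t a)%R.
Proof.
elim: r j n => [|r IH] j n h jn rn.
  have [|->] := binrep_t_cases h; last by rewrite krep_empty.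
  by move/is_binrepP: h => [/andP[]]; lia.
have [tr|->] := binrep_t_cases h; last by rewrite krep_empty kk_lt0.
have pn := binrep_top_le h tr jn.
have [rp|pr] := leqP r.*2 (a r.+1).
  have [_ _ _ h'] := binrep_top h tr.
  apply: (@le_lt_trans _ _ (kk r.+1 (a r.+1).+1)); first by apply: kk_anti; lia.
  rewrite krepS // -kkS addrC ltrD2r.
  exact: IH h' (binrep_rest_lt h tr) rp.
(* A top entry below [2r] keeps [j] under ['C(2r + 1, r + 1)], so [krep_ge0] applies. *)
apply: (@lt_le_trans _ _ 0%R); first exact: kk_lt0.
apply: (krep_ge0 _ _ _ _ h); apply: leq_trans (binrep_lt h tr) _.
by apply: leq_bin2l; lia.
Qed.

Lemma krep_gt0 r m t a : is_binrep r.+1 m t a -> t <= r.+1 ->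
  a r.+1 <= r.*2 -> (0 < krep r.+1 t a)%R.
Proof.
move=> h tr ar; have [_ ra _ h'] := binrep_top h tr.
have := binrep_rest_lt h tr; rewrite krepS //.
move: ar ra h'; move: (a r.+1) => p; rewrite leq_eqVlt => /orP[/eqP pE|pr] ra h' hlt.
  (* With top entry [2r], the top term is [- kk r r.*2], as the two add up to [kk r.+1 r.*2.+1 = 0];
     the strict bound on the remainder decides. *)
  rewrite -(kk_odd r) -kkS -pE addrC ltrD2r.
  by apply: kk_lt_krep h' hlt _; rewrite pE.
apply: ltr_wpDl; last by apply: kk_gt0; lia.
by apply: krep_ge0 h' _; apply: leq_trans hlt _; apply: leq_bin2l; lia.
Qed.

Lemma krep_le r m t a j s b : is_binrep r m t a -> is_binrep r j s b ->
  j <= m -> (forall i, t <= i <= r -> 2 * i - 1 <= a i) ->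
  (krep r t a <= krep r s b)%R.
Proof.
elim: r m j t s b => [|r IH] m j t s b hm hj jm good.
  rewrite /krep !big_nat !big1 // => i; last first.
  - by move/is_binrepP: hm => [/andP[? _] _ _ _]; lia.
  - by move/is_binrepP: hj => [/andP[? _] _ _ _]; lia.
have [tr|tr] := binrep_t_cases hm; last first.
  have m0 : m = 0 by move/is_binrepP: hm => [_ _ _ ->]; rewrite tr big_geq.
  have j0 : j = 0 by lia.
  rewrite tr krep_empty; have [sr|->] := binrep_t_cases hj; last by rewrite krep_empty.
  by have [] := binrep_top hj sr; rewrite j0 leqn0 eqn0Ngt bin_gt0 => /negP.
have [Cm _ _ hm'] := binrep_top hm tr.
have good' i : t <= i <= r -> 2 * i - 1 <= a i by move=> ?; apply: good; lia.
have goodr : r.*2.+1 <= a r.+1 by have := good r.+1; rewrite tr leqnn => /(_ isT); lia.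
have [jlt|jge] := ltnP j 'C(a r.+1, r.+1).
  apply: (@le_trans _ _ (kk r.+1 (a r.+1))); last exact: kk_le_krep hj jlt _.
  (* The remainder of [m] contributes at most [0], by comparison with the empty representation. *)
  rewrite krepS // gerDr -(krep_empty r a).
  exact: IH hm' (binrep_empty r a) _ good'.
have [sr|sr] := binrep_t_cases hj; last first.
  move: jge; move/is_binrepP: hj => [_ _ _ ->]; rewrite sr big_geq //.
  by rewrite leqNgt bin_gt0; lia.
have [Cj _ _ hj'] := binrep_top hj sr.
(* Here [j] lies between ['C(a r.+1, r.+1)] and [m], which forces equal top entries. *)
have eab : a r.+1 = b r.+1.
  have ba := binrep_top_le hj sr (leq_ltn_trans jm (binrep_lt hm tr)).
  apply/eqP; rewrite eqn_leq; apply/andP; split; last exact: ba.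
  rewrite leqNgt; apply/negP => lt.
  have := leq_trans (binrep_lt hj sr) (leq_bin2l r.+1 lt).
  by rewrite ltnNge jge.
rewrite !krepS // eab lerD2r; apply: IH hm' hj' _ good'.
by rewrite eab leq_sub2r.
Qed.

(** Puts a top term back on a truncated remainder: [j < 'C(n, r)] keeps the top entry of [b] below
    [n]. *)
Lemma binrep_cons {r j s b n} : is_binrep r j s b -> j < 'C(n, r) -> r < n ->
  is_binrep r.+1 ('C(n, r.+1) + j) s (fun i => if i == r.+1 then n else b i).
Proof.
move=> h jn rn; have /is_binrepP[/andP[s0 sr] hs hi E] := h.
apply/is_binrepP; split; first by rewrite s0 (leq_trans sr).
- by move=> _; case: eqP => [->|] //; lia.
- move=> i /andP[si ir]; rewrite (ltn_eqF ir) eqSS.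
  case: eqP => [ir'|?]; last by apply: hi; lia.
  case: r h jn hs hi E rn sr ir ir' => [|r] h jn hs hi E rn sr ir ir'; first lia.
  by rewrite ir'; apply: (binrep_top_le h _ jn); lia.
- rewrite big_nat_recr //= eqxx addnC; congr addn; rewrite E.
  by apply: eq_big_nat => i /andP[_ ir]; rewrite (ltn_eqF ir).
Qed.

Lemma krep_drop {r m t a i} : is_binrep r m t a -> t <= i <= r ->
  a i < 2 * i - 1 ->
  exists j s b, [/\ j < m, is_binrep r j s b & (krep r s b < krep r t a)%R].
Proof.
elim: r m => [|r IH] m h tir ai.
  by move/is_binrepP: h => [/andP[? _] _ _ _]; lia.
have tr : t <= r.+1 by lia.
have [Cm ra _ h'] := binrep_top h tr.
have [ar|ar] := leqP (a r.+1) r.*2.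
  (* The top entry is already too small: everything is dropped, leaving the empty representation of
     [0]. *)
  exists 0, r.+2, a; rewrite krep_empty; split; last exact: krep_gt0 h tr ar.
    by apply: leq_trans Cm; rewrite bin_gt0.
  exact: binrep_empty.
have ir : t <= i <= r.
  have : i != r.+1 by apply/eqP => e; move: ai; rewrite e; lia.
  by lia.
have [j [s [b [jm hj lt]]]] := IH _ h' ir ai.
have jC := ltn_trans jm (binrep_rest_lt h tr).
exists ('C(a r.+1, r.+1) + j), s, (fun i => if i == r.+1 then a r.+1 else b i).
split; [by rewrite -ltn_subRL | exact: binrep_cons hj jC ra | ].
have sr : s <= r.+1 by move/is_binrepP: hj => [/andP[]].
rewrite !krepS // eqxx ltrD2r; congr (_ < _)%R: lt.
by apply: eq_big_nat => k /andP[_ kr]; rewrite (ltn_eqF kr).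
Qed.

Lemma kappa_starP r m :
  kappa r m = kappa_star r m <-> forall j, j <= m -> (kappa r m <= kappa r j)%R.
Proof.
rewrite /kappa_star big_mkord; split=> [-> j jm|min].
  exact: (bigmin_le _ (Ordinal (jm : j < m.+1))).
apply/eqP; rewrite eq_le; apply/andP; split; last exact: (bigmin_le _ ord_max).
(* The default value of the minimum is the case [j = 0]. *)
by apply: le_bigmin => [|j _]; apply: min => //; rewrite -ltnS.
Qed.

Theorem theorem2p3 (r m t : nat) (a : nat -> nat) :
  0 < r -> is_binrep r m t a ->
  (kappa r m = kappa_star r m <-> forall i : nat, t <= i <= r -> 2 * i - 1 <= a i).
Proof.
move=> r0 h; rewrite kappa_starP; split=> [min i ti | good j jm].
  rewrite leqNgt; apply/negP => ai.
  have [j [s [b [jm hj]]]] := krep_drop h ti ai.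
  by rewrite -(kappa_krep r0 h) -(kappa_krep r0 hj) ltNge min // ltnW.
have hj := binrep_correct j r0.
by rewrite (kappa_krep r0 h) (kappa_krep r0 hj); apply: krep_le h hj jm good.
Qed.
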